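(* For every positive integer $n$, $M_{\mathrm{odd}}(n)\le n(n-1)+1$. Moreover, $M_{\mathrm{odd}}(2k)\ge k^2$ for every integer $k\ge 1$, and $M_{\mathrm{odd}}(2k+1)\ge k(k+2)$ for every integer $k\ge 1$. In particular, $M_{\mathrm{odd}}(n)=\Theta(n^2)$ as $n\to\infty$.
   Context: A lattice path is a finite sequence of vertices $F=(v_0,v_1,\dots,v_k)\in(\mathbb Z^2)^{k+1}$ such that $v_i-v_{i-1}\in\{(0,1),(1,0)\}$ for all $1\le i\le k$ (a North-East lattice path). It is a path from $v_0$ to $v_k$. Its edge set is $E(F)=\{\{v_i,v_{i+1}\}:0\le i<k\}$. For two lattice paths $F,G$ both starting at $(0,0)$, define $F\cap G:=E(F)\cap E(G)$, so that $|F\cap G|$ is the number of common edges. For a positive integer $n$, $M_{\mathrm{odd}}(n)$ denotes the maximum of $|\mathcal F|$ over all families (sets) $\mathcal F$ of lattice paths from $(0,0)$ to $(n,n)$ such that $|F\cap G|$ is odd for all $F,G\in\mathcal F$ with $F\ne G$. *)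

(* Defs.v *)
From mathcomp Require Import all_boot all_order all_algebra finmap.
From mathcomp Require Import zify boolp.

Set Implicit Arguments.
Unset Strict Implicit.
Unset Printing Implicit Defensive.

Import Order.TTheory GRing.Theory Num.Theory.

Local Open Scope fset_scope.
Local Open Scope ring_scope.

Notation vertex := (int * int)%type.

Definition origin : vertex := (0, 0).
Definition north : vertex := (0, 1).
Definition east : vertex := (1, 0).

Definition step (u v : vertex) : bool := v - u \in [:: north; east].

Definition lattice_path (F : seq vertex) : bool :=
  (F != [::]) && sorted step F.

Definition lattice_path_from_to (u v : vertex) (F : seq vertex) : bool :=
  [&& lattice_path F, head u F == u & last u F == v].

(* [zip F (behead F)] lists the pairs (v_i, v_(i+1)) for 0 <= i < k. *)
Definition edges (F : seq vertex) : {fset {fset vertex}} :=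
  [fset [fset e.1; e.2] | e in zip F (behead F)].

Definition endpoint (n : nat) : vertex := (n%:Z, n%:Z).

(* There are only finitely many lattice paths between two given vertices, so
   no family is lost by taking families to be finite sets. *)
Definition odd_family (n : nat) (Fam : {fset seq vertex}) : Prop :=
  (forall F, F \in Fam -> lattice_path_from_to origin (endpoint n) F) /\
  (forall F G, F \in Fam -> G \in Fam -> F <> G ->
     odd #|` edges F `&` edges G|).

Definition odd_family_card (n m : nat) : Prop :=
  exists2 Fam, odd_family n Fam & #|` Fam| = m.

Fixpoint paths_from (k : nat) (u : vertex) : seq (seq vertex) :=
  if k is k'.+1 then
    [seq u :: p | p <- paths_from k' (u + north) ++ paths_from k' (u + east)]
  else [:: [:: u]].

Lemma mem_paths_from x s : path step x s -> x :: s \in paths_from (size s) x.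
Proof.
elim: s x => [|y s IHs] x /=; first by rewrite inE.
case/andP=> xy /IHs ys; apply: map_f; rewrite mem_cat.
have yE : y = x + (y - x) by rewrite addrC subrK.
by move: xy; rewrite /step !inE => /orP[] /eqP <-; rewrite -yE ys ?orbT.
Qed.

Lemma path_step_size x s : path step x s ->
  (last x s).1 + (last x s).2 = x.1 + x.2 + (size s)%:Z.
Proof.
elim: s x => [|y s IHs] x /=; first by rewrite addr0.
case/andP=> xy /IHs ->.
have yE : y = x + (y - x) by rewrite addrC subrK.
by move: xy; rewrite /step !inE => /orP[] /eqP xy; rewrite yE xy /=; lia.
Qed.

Lemma lattice_path_mem_paths n F :
  lattice_path_from_to origin (endpoint n) F -> F \in paths_from (n + n) origin.
Proof.
case/and3P=> /andP[]; case: F => //= x s _ xs /eqP x0 /eqP lst.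
have := path_step_size xs; rewrite lst x0 /= => sz.
have -> : (n + n)%N = size s by lia.
by subst x; apply: mem_paths_from.
Qed.

Lemma odd_family_card_ex n : exists m, `[< odd_family_card n m >].
Proof. by exists 0%N; apply/asboolP; exists fset0; rewrite ?cardfs0. Qed.

Lemma odd_family_card_bound n m : `[< odd_family_card n m >] ->
  (m <= size (paths_from (n + n) origin))%N.
Proof.
move/asboolP => -[Fam [FamP _] <-]; apply: uniq_leq_size => // F.
by move/FamP/lattice_path_mem_paths.
Qed.

Definition M_odd (n : nat) : nat :=
  ex_maxn (odd_family_card_ex n) (@odd_family_card_bound n).

(* Main.v *)
Require Import Defs.
From mathcomp Require Import all_boot all_order all_algebra.
From mathcomp Require Import all_classical all_reals all_analysis.
From mathcomp Require Import finmap zify.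

Set Implicit Arguments.
Unset Strict Implicit.
Unset Printing Implicit Defensive.

Import GRing.Theory Num.Theory.
Import numFieldNormedType.Exports.

(** A path is coded by its abscissa [g t] after [t] steps. Since the sum of the
coordinates increases by one at each step, two paths can share an edge only if
both traverse it at the same time, so the number of common edges is a sum over
time ([card_edgesI]).

Upper bound. Work over the field with two elements. Say that a unit cell lies
to the left of a path if the path passes below it and to its right. An edge
belongs to the path [f] exactly when one of the two cells flanking it is to the
left of [f] and the other is not. Summing over the edges of a second path [g],
the parity of the number of common edges is a term depending on [g] alone
(from the cells outside the square, whose position is the same for every [f])
plus the scalar product of the indicator of the [n * n] inner cells to the left
of [f] with the vector counting how often each cell flanks [g]
([common_mod2]). The second vector is restricted: if [Z] is a function on
cells of the form [p (a + b) + p (a - b)], with [p] even and symmetric around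
[n + 1], its sum over the cells flanking a path telescopes to zero, and [Z]
vanishes outside the square ([flank_bicycle]). The boundary operator sends
these [Z] to the elements of the bicycle space of the grid (cycles that are
also cuts). There are [n] independent ones, so the parity matrix of a family
has rank at most [n * n - n + 1]. For an even number of paths the matrix of a
family with odd pairwise intersections is [J + I], which is its own inverse,
hence the size is at most [n * (n - 1) + 1]; this number is odd, so that
discarding a path from a larger family gives the bound for odd sizes as well.

Lower bounds. A path is determined by the height of its east step in each
column, or by the abscissa of its north step in each row, and the number of
common edges is the number of columns plus the number of rows where two paths
agree ([common_staircase]). For [n = 2k + c] with [c] at most one, the comb
paths follow the left side of the square (after [c] east steps) up to an even
height [r], go east by an odd length [j], step north, go east to the right side
and then north: all pairs meet oddly, and there are [(k + c) * k] of them. When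
[c = 1] the family admits [k] more paths, which avoid the first east step and
reach the end along a row just below the top ([hook_h], [hook_w]). *)

(** * Paths as functions of time *)

Definition walk (n : nat) (g : nat -> nat) : Prop :=
  [/\ g 0 = 0, forall t, t < n + n -> g t <= g t.+1 <= (g t).+1 & g (n + n) = n].

Definition site (g : nat -> nat) (t : nat) : vertex :=
  (Posz (g t), (t%:Z - (g t)%:Z)%R).

Definition walk_path (n : nat) (g : nat -> nat) : seq vertex :=
  [seq site g t | t <- iota 0 (n + n).+1].

Lemma vertexDE (u v : vertex) : (u + v)%R = ((u.1 + v.1)%R, (u.2 + v.2)%R).
Proof. by []. Qed.

Lemma vertexBE (u v : vertex) : (u - v)%R = ((u.1 - v.1)%R, (u.2 - v.2)%R).
Proof. by []. Qed.

Lemma walk_bounds n g t : walk n g -> t <= n + n ->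
  [/\ g t <= t, g t <= n & t <= n + g t].
Proof.
move=> [g0 gS gn] tn.
have lo s : s <= n + n -> g s <= s.
  by elim: s => [|s IHs] sn; [rewrite g0 | have := gS s sn; have := IHs (ltnW sn); lia].
have hi d : d <= n + n -> g (n + n - d) <= n /\ n <= g (n + n - d) + d.
  elim: d => [|d IHd] dn; first by rewrite subn0 gn; lia.
  have := IHd (ltnW dn).
  have -> : n + n - d = (n + n - d.+1).+1 by lia.
  by have := gS (n + n - d.+1); lia.
have := hi (n + n - t); rewrite subKn //.
by have := lo _ tn; split; lia.
Qed.

Lemma size_walk_path n g : size (walk_path n g) = (n + n).+1.
Proof. by rewrite size_map size_iota. Qed.

Lemma nth_walk_path n g t : t <= n + n -> nth origin (walk_path n g) t = site g t.
Proof. by move=> tn; rewrite (nth_map 0) ?size_iota // nth_iota. Qed.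

Lemma walk_path_lattice n g : walk n g ->
  lattice_path_from_to origin (endpoint n) (walk_path n g).
Proof.
move=> gW; have [g0 gS gn] := gW.
have pN : walk_path n g != [::] by rewrite -size_eq0 size_walk_path.
apply/and3P; split.
- rewrite /lattice_path pN; apply/(sortedP origin) => t; rewrite size_walk_path ltnS => tn.
  rewrite !nth_walk_path ?(ltnW tn) // /step /site vertexBE !inE !xpair_eqE /=.
  have := gS t tn; lia.
- by rewrite -nth0 nth_walk_path // /site g0.
by rewrite -nth_last size_walk_path nth_walk_path // /site gn xpair_eqE /=; lia.
Qed.

Lemma walk_pathP n F :
  lattice_path_from_to origin (endpoint n) F ->
  exists2 g, walk n g & F = walk_path n g.
Proof.
case/and3P => /andP[]; case: F => //= x s _ xs /eqP x0 /eqP lst.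
have szs : size s = n + n.
  by have := path_step_size xs; rewrite lst x0 /=; lia.
have stepF t : t < n + n ->
    nth origin s t = (nth origin (x :: s) t + north)%R \/
    nth origin s t = (nth origin (x :: s) t + east)%R.
  rewrite -szs => ts; have := (pathP origin xs) t ts.
  by rewrite /step !inE => /orP[] /eqP <-; [left|right]; rewrite addrC subrK.
pose g t := `|(nth origin (x :: s) t).1|%N.
have gE t : t <= n + n -> nth origin (x :: s) t = site g t.
  rewrite /site /g; elim: t => [|t IHt] tn; first by rewrite /= x0.
  rewrite [nth _ _ t.+1]/=.
  have {}IHt := IHt (ltnW tn).
  by case: (stepF t tn) => ->; rewrite IHt vertexDE; apply/eqP; rewrite xpair_eqE /=; lia.
exists g; first split.
- by rewrite /g /= x0.
- move=> t tn; rewrite /g [nth _ _ t.+1]/=.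
  by case: (stepF t tn) => ->; rewrite (gE _ (ltnW tn)) vertexDE /=; lia.
- by have := nth_last origin (x :: s); rewrite /g /= szs lst => ->.
apply: (@eq_from_nth _ origin) => [|t]; first by rewrite size_map size_iota /= szs.
rewrite /= szs => tn.
by rewrite (nth_map 0) ?size_iota // nth_iota // gE.
Qed.

Definition walk_edge (g : nat -> nat) (t : nat) : {fset vertex} :=
  [fset site g t; site g t.+1]%fset.

Definition common (n : nat) (f g : nat -> nat) : nat :=
  \sum_(t < n + n) ((f t == g t) && (f t.+1 == g t.+1)).

(** The coordinates of [site g t] add up to [t], so an edge remembers the time
at which it is traversed. *)
Lemma walk_edge_inj f g s t :
  walk_edge f s = walk_edge g t -> [/\ s = t, f s = g t & f s.+1 = g t.+1].
Proof.
move=> E.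
have h1 : site f s \in walk_edge g t by rewrite -E !inE eqxx.
have h2 : site f s.+1 \in walk_edge g t by rewrite -E !inE eqxx orbT.
have h3 : site g t \in walk_edge f s by rewrite E !inE eqxx.
move: h1 h2 h3 => {E}; rewrite !inE !xpair_eqE => h1 h2 h3.
have {h1} h1 : s = t /\ f s = g t \/ s = t.+1 /\ f s = g t.+1.
  by case/orP: h1 => /andP[/eqP h /eqP h']; [left|right]; lia.
have {h2} h2 : s.+1 = t /\ f s.+1 = g t \/ s.+1 = t.+1 /\ f s.+1 = g t.+1.
  by case/orP: h2 => /andP[/eqP h /eqP h']; [left|right]; lia.
have {h3} h3 : t = s \/ t = s.+1.
  by case/orP: h3 => /andP[/eqP h /eqP h']; [left|right]; lia.
by split; lia.
Qed.

Lemma edges_walk_path n g e :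
  reflect (exists2 t, t < n + n & e = walk_edge g t) (e \in edges (walk_path n g)).
Proof.
have zE : zip (walk_path n g) (behead (walk_path n g)) =
    [seq (site g t, site g t.+1) | t <- iota 0 (n + n)].
  have sz : size (behead (walk_path n g)) = n + n by rewrite size_behead size_walk_path.
  apply: (@eq_from_nth _ (origin, origin)) => [|t].
    by rewrite size_zip sz size_walk_path size_map size_iota; apply/minn_idPr.
  rewrite size_zip sz size_walk_path (minn_idPr (leqnSn _)) => tn.
  rewrite nth_zip_cond size_zip sz size_walk_path (minn_idPr (leqnSn _)) tn.
  rewrite nth_behead !nth_walk_path ?(ltnW tn) //.
  by rewrite (nth_map 0) ?size_iota // nth_iota.
apply: (iffP (imfsetP _ _ _ _)); rewrite zE /=.
  by case=> x /mapP[t]; rewrite mem_iota => tn -> ->; exists t.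
by case=> t tn ->; exists (site g t, site g t.+1) => //; apply: map_f; rewrite mem_iota.
Qed.

Lemma card_edgesI n f g :
  #|` edges (walk_path n f) `&` edges (walk_path n g)|%fset = common n f g.
Proof.
pose S := [seq t <- iota 0 (n + n) | (f t == g t) && (f t.+1 == g t.+1)].
have -> : (edges (walk_path n f) `&` edges (walk_path n g) =
    [fset walk_edge f t | t in S])%fset.
  apply/fsetP => e; rewrite in_fsetI; apply/andP/imfsetP.
    case=> /edges_walk_path[t tn ->] /edges_walk_path[s sn /walk_edge_inj[ts e1 e2]].
    by exists t => //=; rewrite mem_filter mem_iota {1}e1 {1}e2 ts !eqxx /= -ts.
  case=> t /=; rewrite mem_filter mem_iota => /andP[/andP[/eqP e1 /eqP e2] tn] ->.
  split; apply/edges_walk_path; exists t => //.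
  by rewrite /walk_edge /site e1 e2.
rewrite card_imfset /=; last by move=> s t /walk_edge_inj[].
have -> : size (enum_finmem (mem S)) = size S.
  apply/perm_size/uniq_perm; rewrite ?enum_finmem_uniq ?filter_uniq ?iota_uniq //.
  by move=> t; rewrite enum_finmemE.
rewrite /S size_filter /common -sum1_count big_mkcond /=.
by rewrite -(subn0 (n + n)) big_mkord subn0; apply: eq_bigr => i _; case: (_ && _).
Qed.

Lemma common_diag n f : common n f f = n + n.
Proof.
by rewrite /common; under eq_bigr do rewrite !eqxx; rewrite sum1_card card_ord.
Qed.

Lemma M_odd_walks n m : m <= M_odd n ->
  exists2 f : 'I_m -> nat -> nat, (forall k, walk n (f k)) &
    forall k l, k != l -> odd (common n (f k) (f l)).
Proof.
rewrite /M_odd; case: ex_maxnP => M /asboolP[Fam [FamP FamO] cFam] _ mM.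
pose F k := nth [::] (enum_fset Fam) k.
have FamF (k : 'I_m) : F k \in Fam.
  by apply: mem_nth; rewrite cFam; exact: leq_trans (ltn_ord k) mM.
have [f fW Ff] := fin_all_exists2 (fun k => walk_pathP (FamP _ (FamF k))).
exists f => // k l kl; rewrite -card_edgesI -!Ff; apply: FamO => // /eqP.
have sz (i : 'I_m) : i < size (enum_fset Fam).
  by rewrite cFam; exact: leq_trans (ltn_ord i) mM.
by rewrite nth_uniq ?fset_uniq // => /eqP/val_inj/eqP; apply/negP.
Qed.

(** A path has an even number of edges, so odd intersections for distinct
indices force the paths themselves to be distinct. *)
Lemma walks_M_odd n (I : finType) (f : I -> nat -> nat) :
  (forall i, walk n (f i)) ->
  (forall i j, i != j -> odd (common n (f i) (f j))) -> #|I| <= M_odd n.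
Proof.
move=> fW fO.
have pI : injective (fun i => walk_path n (f i)).
  move=> i j pij; apply/eqP; apply: contraT => /fO.
  by rewrite -card_edgesI pij card_edgesI common_diag addnn odd_double.
rewrite /M_odd; case: ex_maxnP => M _; apply; apply/asboolP.
exists [fset walk_path n (f i) | i in I]%fset; last first.
  by rewrite card_imfset //= cardE.
split=> [F /imfsetP[i _ ->]|F G /imfsetP[i _ ->] /imfsetP[j _ ->] ne].
  exact: walk_path_lattice.
by rewrite card_edgesI fO //; apply/eqP => ij; apply: ne; rewrite ij.
Qed.

(** * Parity of the intersection as a scalar product *)

Local Open Scope ring_scope.

Lemma natF2 a b : odd a = odd b -> a%:R = b%:R :> 'F_2.
Proof. by move=> e; apply/val_inj; rewrite /= !val_Fp_nat // !modn2 e. Qed.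

Lemma addF2 (a : 'F_2) : a + a = 0.
Proof. by case: a => [[|[|//]] ?]; apply/val_inj. Qed.

Lemma telescopeF2 N (u : nat -> 'F_2) :
  \sum_(t < N) (u t + u t.+1) = u 0%N + u N.
Proof.
elim: N => [|N IHN]; first by rewrite big_ord0 addF2.
by rewrite big_ord_recr /= IHN addrA -(addrA (u 0%N)) addF2 addr0.
Qed.

(** Cells are indexed by [a] and [b] from [0] to [n + 1], with [0] and [n + 1]
standing for the cells just outside the square; the cell [(a, b)] has upper
right corner [(a, b)]. The path crosses the antidiagonal of this cell at time
[a + b - 1]. *)
Definition left_of (f : nat -> nat) (i j : nat) : bool := (i <= f (i + j).-1)%N.

(** The two cells flanking the edge traversed by [g] at time [t] have upper
right corners [site g t + (1, 1)] and [site g t.+1]; the edge is on the path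
[f] exactly when [f] separates them. *)
Lemma common_left_of n f g t : walk n f -> walk n g -> (t < n + n)%N ->
  ((f t == g t) && (f t.+1 == g t.+1))%:R =
  (left_of f (g t).+1 (t - g t).+1)%:R +
  (left_of f (g t.+1) (t.+1 - g t.+1))%:R :> 'F_2.
Proof.
move=> fW gW tn; rewrite -natrD; apply: natF2; rewrite /left_of.
have [[_ fS _] [_ gS _]] := (fW, gW).
have := (fS t tn, gS t tn).
have [b1 _ _] := walk_bounds gW (ltnW tn).
have [b2 _ _] := walk_bounds gW tn.
have -> : ((g t).+1 + (t - g t).+1).-1 = t.+1 by lia.
have -> : (g t.+1 + (t.+1 - g t.+1)).-1 = t by lia.
move: (f t) (g t) (f t.+1) (g t.+1) => a b c d [h1 h2].
by case: eqP; case: eqP; case: ltnP; case: leqP => //=; lia.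
Qed.

Definition flank (n : nat) (Z : nat -> nat -> 'F_2) (g : nat -> nat) : 'F_2 :=
  \sum_(t < n + n)
    (Z (g t).+1 (t - g t).+1%N + Z (g t.+1) (t.+1 - g t.+1)%N).

(** Cells flanking a path avoid the outer corner [(n + 1, n + 1)], where
[left_of] would read its argument after the end of the path. *)
Lemma flank_eq n Z Z' g : walk n g ->
  (forall a b, (a <= n.+1)%N -> (b <= n.+1)%N -> (a + b <= (n + n).+1)%N -> Z a b = Z' a b) ->
  flank n Z g = flank n Z' g.
Proof.
move=> gW ZE; apply: eq_bigr => t _.
have tn := ltn_ord t.
have [b1 b2 b3] := walk_bounds gW (ltnW tn).
have [c1 c2 c3] := walk_bounds gW tn.
by congr (_ + _); apply: ZE; lia.
Qed.

Definition cell n (i j : 'I_n) (a b : nat) : 'F_2 := ((a == i.+1) && (b == j.+1))%:R.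

Lemma sum_cell n (Z : nat -> nat -> 'F_2) a b :
  \sum_(i < n) \sum_(j < n) Z i.+1 j.+1 * cell i j a b =
  Z a b * ((0 < a <= n) && (0 < b <= n))%N%:R.
Proof.
rewrite /cell pair_big /=; case: (boolP (_ && _)) => [/andP[/andP[a0 an] /andP[b0 bn]]|nab].
  have an' : (a.-1 < n)%N by lia.
  have bn' : (b.-1 < n)%N by lia.
  rewrite (bigD1 (Ordinal an', Ordinal bn')) //= !prednK // !eqxx /= big1 ?addr0 //.
  move=> [i j] /= ne; case: eqP => [ai|]; last by rewrite mulr0.
  case: eqP => [bj|]; last by rewrite mulr0.
  by case/eqP: ne; congr (_, _); apply/val_inj => /=; lia.
rewrite mulr0 big1 // => -[i j] _ /=.
have li := ltn_ord i; have lj := ltn_ord j.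
by rewrite (_ : _ && _ = false) ?mulr0 //; apply/negbTE; lia.
Qed.

Definition touch n (g : nat -> nat) : 'M['F_2]_n := \matrix_(i, j) flank n (cell i j) g.

Lemma flank_sum n (Z : nat -> nat -> 'F_2) g :
  flank n (fun a b => \sum_(i < n) \sum_(j < n) Z i.+1 j.+1 * cell i j a b) g =
  \sum_(i < n) \sum_(j < n) Z i.+1 j.+1 * touch n g i j.
Proof.
rewrite /flank; under eq_bigr do rewrite -big_split /=.
rewrite exchange_big; apply: eq_bigr => i _ /=.
under eq_bigr do rewrite -big_split /=.
rewrite exchange_big; apply: eq_bigr => j _ /=.
by rewrite mxE /flank mulr_sumr; apply: eq_bigr => t _; rewrite mulrDr.
Qed.

(** The outer cells to the left of every path: those beyond the left side and
those above the top side. *)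
Definition rim (n a b : nat) : bool := (a == 0) || (b == n.+1) && (a <= n)%N.

Lemma left_of_rim n f a b : walk n f -> (a <= n.+1)%N -> (b <= n.+1)%N ->
  (a + b <= (n + n).+1)%N ->
  (left_of f a b)%:R =
  (rim n a b)%:R + \sum_(i < n) \sum_(j < n) (left_of f i.+1 j.+1)%:R * cell i j a b :> 'F_2.
Proof.
move=> fW an bn abn; rewrite (sum_cell n (fun a b => (left_of f a b)%:R)).
have [b1 b2 b3] : [/\ f (a + b).-1 <= (a + b).-1, f (a + b).-1 <= n
   & (a + b).-1 <= n + f (a + b).-1]%N by apply: walk_bounds => //; lia.
rewrite -natrM -natrD; congr (_%:R); move: b1 b2 b3; rewrite /left_of /rim.
move: (f (a + b).-1) => x; lia.
Qed.

Lemma common_mod2 n f g : walk n f -> walk n g ->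
  (common n f g)%:R = flank n (fun a b => (rim n a b)%:R) g +
    \sum_(i < n) \sum_(j < n) (left_of f i.+1 j.+1)%:R * touch n g i j :> 'F_2.
Proof.
move=> fW gW; rewrite /common natr_sum; under eq_bigr do rewrite (@common_left_of n) //.
rewrite -[LHS]/(flank n (fun a b => (left_of f a b)%:R) g).
pose S a b : 'F_2 := \sum_(i < n) \sum_(j < n) (left_of f i.+1 j.+1)%:R * cell i j a b.
rewrite (@flank_eq _ _ (fun a b => (rim n a b)%:R + S a b)) //; last first.
  by move=> *; apply: left_of_rim.
rewrite -(flank_sum n (fun a b => (left_of f a b)%:R)) /flank -big_split.
by apply: eq_bigr => t _; rewrite addrACA.
Qed.

(** * Cell functions orthogonal to all paths *)

(** The indicator of the integers of the parity of [c + 1] strictly between [c]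
and its mirror image in [n + 1]. *)
Definition pulse (n c t : nat) : 'F_2 :=
  ((c < t < n.+1 + n.+1 - c)%N && odd (t + c))%:R.

(** The sum of two truncated differences is the distance from [a] to [b]. *)
Definition bicycle (n c a b : nat) : 'F_2 :=
  pulse n c (a + b) + pulse n c (a - b + (b - a)).

Lemma bicycle_border n c a b : (a <= n.+1)%N -> (b <= n.+1)%N ->
  ~~ ((0 < a <= n) && (0 < b <= n))%N -> bicycle n c a b = 0.
Proof.
move=> an bn nab; rewrite /bicycle /pulse -natrD; apply: (@natF2 _ 0).
have : [\/ a = 0, b = 0, a = n.+1 | b = n.+1]%N.
  have [->|a0] := eqVneq a 0%N; first by constructor 1.
  have [->|b0] := eqVneq b 0%N; first by constructor 2.
  have [->|a1] := eqVneq a n.+1; first by constructor 3.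
  by constructor 4; lia.
case=> e; subst; rewrite oddD !oddb; lia.
Qed.

Lemma bicycle_first_row n c x : (0 < c <= n)%N -> (0 < x <= n)%N ->
  bicycle n c x 1 = (x == c)%:R.
Proof. by move=> cn xn; rewrite /bicycle /pulse -natrD; apply: natF2; lia. Qed.

(** Along the two cells flanking an edge of the path, the sum [a + b] takes two
consecutive values and the difference [a - b] takes its values at both ends of
the edge, so both halves of [bicycle] telescope. *)
Lemma flank_bicycle n c g : (0 < c)%N -> walk n g -> flank n (bicycle n c) g = 0.
Proof.
move=> c0 gW; have [g0 _ gn] := gW.
pose d t := (g t - (t - g t) + (t - g t - g t))%N.
transitivity (\sum_(t < n + n) (pulse n c t.+1 + pulse n c t.+2)
            + \sum_(t < n + n) (pulse n c (d t) + pulse n c (d t.+1))).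
  rewrite -big_split; apply: eq_bigr => t _ /=; rewrite /bicycle.
  have tn := ltn_ord t.
  have [b1 _ _] := walk_bounds gW (ltnW tn).
  have [c1 _ _] := walk_bounds gW tn.
  have -> : ((g t).+1 + (t - g t).+1)%N = t.+2 by lia.
  have -> : (g t.+1 + (t.+1 - g t.+1))%N = t.+1 by lia.
  by rewrite !subSS addrACA [X in X + _]addrC.
rewrite (telescopeF2 _ (fun t => pulse n c t.+1)) (telescopeF2 _ (fun t => pulse n c (d t))).
rewrite /d g0 gn /pulse -!natrD; apply: (@natF2 _ 0).
have -> : (n - (n + n - n) + (n + n - n - n) = 0)%N by lia.
have -> : (c < 1)%N = false by lia.
have -> : ((n + n).+1 < n.+1 + n.+1 - c)%N = false by lia.
by rewrite !andbF.
Qed.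

Lemma touch_bicycle n c g : (0 < c)%N -> walk n g ->
  \sum_(i < n) \sum_(j < n) bicycle n c i.+1 j.+1 * touch n g i j = 0.
Proof.
move=> c0 gW; rewrite -(flank_sum n (bicycle n c)) -[RHS](flank_bicycle c0 gW).
apply: flank_eq => // a b an bn _; rewrite (sum_cell n (bicycle n c)).
by case: (boolP (_ && _)) => ab; rewrite ?mulr1 // mulr0 bicycle_border.
Qed.

(** * The upper bound *)

Lemma mulmx_mxvec_rows (R : pzSemiRingType) p q m n
    (P : 'I_p -> 'M[R]_(m, n)) (Q : 'I_q -> 'M[R]_(m, n)) k l :
  ((\matrix_i mxvec (P i)) *m (\matrix_i mxvec (Q i))^T) k l =
  \sum_i \sum_j P k i j * Q l i j.
Proof.
rewrite mxE (reindex (uncurry (@mxvec_index m n))) /=; last exact: curry_mxvec_bij.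
by rewrite pair_big; apply: eq_bigr => -[i j] _ /=; rewrite !mxE !mxvecE.
Qed.

(** The [n] functions [bicycle n c] are independent because their first rows
form the identity matrix. *)
Lemma rank_bicycles n : (0 < n)%N ->
  \rank (\matrix_(c < n) mxvec (\matrix_(i < n, j < n) bicycle n c.+1 i.+1 j.+1)) = n.
Proof.
move=> n0; apply/eqP; rewrite -/(row_free _); apply/row_freeP.
pose o := Ordinal n0.
exists (\matrix_(x < n) mxvec (delta_mx x o))^T.
apply/matrixP => c x; rewrite mulmx_mxvec_rows (bigD1 x) //= (bigD1 o) //=.
rewrite !mxE !eqxx mulr1 bicycle_first_row ?ltn_ord // big1 ?addr0 => [|j jo]; last first.
  by rewrite !mxE (negPf jo) andbF mulr0.
rewrite big1 ?addr0 => [|i ix]; last first.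
  by rewrite big1 // => j _; rewrite !mxE (negPf ix) mulr0.
by rewrite eqSS eq_sym.
Qed.

(** If [m] is even, the square of [J + 1] is the identity over the field with
two elements, since [J * J = m J]; so the parity matrix has full rank [m]. *)
Lemma even_odd_walks_bound n m (f : 'I_m -> nat -> nat) :
  (0 < n)%N -> (forall k, walk n (f k)) ->
  (forall k l, k != l -> odd (common n (f k) (f l))) ->
  ~~ odd m -> (m <= n * (n - 1) + 1)%N.
Proof.
move=> n0 fW fO mE.
pose X : 'M['F_2]_(m, n * n) :=
  \matrix_k mxvec (\matrix_(i < n, j < n) (left_of (f k) i.+1 j.+1)%:R).
pose T := \matrix_(k < m) mxvec (touch n (f k)).
pose K := \matrix_(c < n) mxvec (\matrix_(i < n, j < n) bicycle n c.+1 i.+1 j.+1).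
pose b : 'rV['F_2]_m := \row_l flank n (fun a b => (rim n a b)%:R) (f l).
pose J : 'M['F_2]_m := const_mx 1.
have gram : J + 1%:M = (const_mx 1 : 'cV_m) *m b + X *m T^T.
  apply/matrixP => k l; rewrite [RHS]mxE mulmx_mxvec_rows !mxE big_ord1 !mxE mul1r.
  transitivity ((common n (f k) (f l))%:R : 'F_2).
    have [->|kl] := eqVneq k l; last by rewrite addr0 (@natF2 _ 1) // fO.
    by rewrite common_diag addF2 (@natF2 _ 0) // addnn odd_double.
  rewrite common_mod2 //; congr (_ + _).
  by apply: eq_bigr => i _; apply: eq_bigr => j _; rewrite [in RHS]mxE.
have KT : K *m T^T = 0.
  apply/matrixP => c l; rewrite mulmx_mxvec_rows [RHS]mxE.
  rewrite -[RHS](touch_bicycle (ltn0Sn c) (fW l)).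
  by apply: eq_bigr => i _; apply: eq_bigr => j _; rewrite [in LHS]mxE.
have rT : (\rank (X *m T^T) <= n * n - n)%N.
  apply: leq_trans (mxrankM_maxr _ _) _.
  rewrite leq_subRL ?leq_pmulr //.
  by move: (mulmx0_rank_max KT); rewrite rank_bicycles.
have JJ : J *m J = 0.
  apply/matrixP => k l; rewrite !mxE; under eq_bigr do rewrite !mxE mulr1.
  by rewrite sumr_const card_ord (@natF2 _ 0) // (negPf mE).
have JU : (J + 1%:M) *m (J + 1%:M) = 1%:M.
  rewrite mulmxDl !mulmxDr JJ !mulmx1 mul1mx add0r addrA.
  suff -> : J + J = 0 by rewrite add0r.
  by apply/matrixP => k l; rewrite !mxE addF2.
have [/mxrank_unit rJ _] := mulmx1_unit JU.
rewrite -[leqLHS]rJ gram mulnBr muln1 addnC.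
apply: leq_trans (mxrank_add _ _) _; apply: leq_add => //.
exact: leq_trans (mxrankM_maxr _ _) (rank_leq_row _).
Qed.

Local Close Scope ring_scope.

Lemma M_odd_upper n : 0 < n -> M_odd n <= n * (n - 1) + 1.
Proof.
move=> n0; rewrite leqNgt; apply/negP; rewrite -addn1 -addnA => /M_odd_walks[f fW fO].
have := even_odd_walks_bound n0 fW fO.
have : ~~ odd (n * (n - 1)) by rewrite oddM; lia.
lia.
Qed.

(** * Paths given by heights of columns and abscissas of rows *)

(** For a path, [h x] is the height of its east step from abscissa [x], and
[w y] the abscissa of its north step from height [y]; the last condition says
that the two describe the same region. *)
Definition staircase (n : nat) (h w : nat -> nat) : Prop :=
  [/\ forall x, x < n -> h x <= n, forall y, y < n -> w y <= n
    & forall x y, x < n -> y < n -> (h x <= y) = (x < w y)].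

Fixpoint stair_walk (n : nat) (h : nat -> nat) (t : nat) : nat :=
  if t is t'.+1 then
    let x := stair_walk n h t' in if (x < n) && (h x <= t' - x) then x.+1 else x
  else 0.

(** The columns already crossed have height at most the current one, and the
rows already climbed have abscissa at most the current one. *)
Lemma stair_inv n h w t (g := stair_walk n h) : staircase n h w -> t <= n + n ->
  [/\ g t <= t, g t <= n, t - g t <= n, forall x, x < g t -> h x <= t - g t
    & forall y, y < t - g t -> w y <= g t].
Proof.
move=> [hn wn hwE].
elim: t => [|t IHt] tn; first by split.
have [i1 i2 i3 i4 i5] := IHt (ltnW tn); rewrite /g /= -/(g t).
case: ifP => [/andP[xn hx]|E].
  split; try lia.
    by move=> x; rewrite ltnS leq_eqVlt => /orP[/eqP->|/i4]; lia.
  by move=> y yx; have := i5 y; lia.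
have yn : t - g t < n.
  by move: E; have [xn|] := ltnP (g t) n; [have := hn _ xn|]; lia.
split; try lia; first by move=> x /i4; lia.
move=> y yx; have [/i5//|yt] := ltnP y (t - g t).
have -> : y = t - g t by lia.
have [xn|xn] := ltnP (g t) n; last by have := wn _ yn; lia.
by move: E; rewrite xn /= hwE //; lia.
Qed.

Lemma stair_walkP n h w : staircase n h w -> walk n (stair_walk n h).
Proof.
move=> S; split=> // [t tn|]; first by rewrite /=; case: ifP; lia.
by have [] := stair_inv S (leqnn (n + n)); lia.
Qed.

Lemma stair_east n h w t (g := stair_walk n h) : staircase n h w ->
  t < n + n -> g t.+1 = (g t).+1 -> g t < n /\ h (g t) = t - g t.
Proof.
move=> S tn; have [hn wn hwE] := S; have [i1 i2 i3 i4 i5] := stair_inv S (ltnW tn).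
rewrite /g /= -/(g t); case: ifP => [/andP[xn hx] _|]; last by lia.
split=> //; apply/eqP; rewrite eqn_leq hx leqNgt /=; apply/negP => hy.
have := i5 (t - g t).-1; have := hwE (g t) (t - g t).-1; rewrite -/g in i1 i3 *; lia.
Qed.

Lemma stair_north n h w t (g := stair_walk n h) : staircase n h w ->
  t < n + n -> g t.+1 = g t -> t - g t < n /\ w (t - g t) = g t.
Proof.
move=> S tn gt; have [hn wn hwE] := S.
have [i1 i2 i3 i4 i5] := stair_inv S (ltnW tn).
have [j1 j2 j3 j4 j5] := stair_inv S tn.
rewrite -/g in i1 i2 i3 i4 i5; rewrite -/g gt in j1 j2 j3 j4 j5.
have yn : t - g t < n by lia.
split=> //; apply/eqP; rewrite eqn_leq j5 /=; last by lia.
have [-> //|x0] := posnP (g t).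
have := i4 (g t).-1; have := hwE (g t).-1 (t - g t); lia.
Qed.

Lemma stair_at_east n h w x (g := stair_walk n h) : staircase n h w ->
  x < n -> g (x + h x) = x /\ g (x + h x).+1 = x.+1.
Proof.
move=> S xn; have [hn wn hwE] := S; have hx := hn x xn.
have [|i1 i2 i3 i4 i5] := @stair_inv n h w (x + h x) S; first by lia.
rewrite -/g in i1 i2 i3 i4 i5.
have gx : g (x + h x) = x.
  have [lt|lt|//] := ltngtP (g (x + h x)) x; last by have := i4 x lt; lia.
  have := i5 (h x); have := hwE x (h x) xn; lia.
by rewrite gx /g /= -/(g _) gx xn addKn leqnn.
Qed.

Lemma stair_at_north n h w y (g := stair_walk n h) : staircase n h w ->
  y < n -> g (y + w y) = w y /\ g (y + w y).+1 = w y.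
Proof.
move=> S yn; have [hn wn hwE] := S; have wy := wn y yn.
have [|i1 i2 i3 i4 i5] := @stair_inv n h w (y + w y) S; first by lia.
rewrite -/g in i1 i2 i3 i4 i5.
have gy : g (y + w y) = w y.
  have [lt|lt|//] := ltngtP (g (y + w y)) (w y); first by have := i5 y; lia.
  have := i4 (w y) lt; have := hwE (w y) y; lia.
rewrite gy /g /= -/(g _) gy addnK; split=> //.
by case: ltnP => //= wn'; rewrite hwE // ltnn.
Qed.

Definition agree (n : nat) (u v : nat -> nat) : nat := \sum_(x < n) (u x == v x).

(** Each path has one east edge per column and one north edge per row, and a
common edge is traversed by both paths at the same time. *)
Lemma common_staircase n h w h' w' :
  staircase n h w -> staircase n h' w' ->
  common n (stair_walk n h) (stair_walk n h') = agree n h h' + agree n w w'.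
Proof.
move=> S S'; set f := stair_walk n h; set g := stair_walk n h'.
have fW : walk n f := stair_walkP S; have [f0 fS fn] := fW.
suff H T : T <= n + n ->
    \sum_(t < T) ((f t == g t) && (f t.+1 == g t.+1)) =
    agree (f T) h h' + agree (T - f T) w w'.
  by rewrite /common; move/(_ _ (leqnn _)): H => ->; rewrite fn addnK.
elim: T => [|t IHt] tn; first by rewrite f0 /agree !big_ord0.
rewrite big_ord_recr /= {}IHt ?(ltnW tn) // /agree.
have [b1 _ _] := walk_bounds fW (ltnW tn).
have [fE|fN] : f t.+1 = (f t).+1 \/ f t.+1 = f t by have := fS t tn; lia.
  have [xn hx] := stair_east S tn fE.
  rewrite fE subSS big_ord_recr /= addnAC; congr (_ + nat_of_bool _ + _).
  apply/andP/eqP => [[/eqP e1 /eqP e2]|e].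
    have [|_] := stair_east S' tn; first by rewrite -/g -e2 -e1.
    by rewrite -/g -e1 hx => ->.
  have [] := stair_at_east S' xn; rewrite -/g -e hx subnKC // => -> ->.
  by rewrite !eqxx.
have [yn wy] := stair_north S tn fN.
rewrite fN subSn // big_ord_recr /= addnA; congr (_ + nat_of_bool _).
apply/andP/eqP => [[/eqP e1 /eqP e2]|e].
  have [|_] := stair_north S' tn; first by rewrite -/g -e2 -e1.
  by rewrite -/g -e1 wy => ->.
have [] := stair_at_north S' yn; rewrite -/g -e wy subnK // => -> ->.
by rewrite !eqxx.
Qed.

Lemma staircases_M_odd n (I : finType) (h w : I -> nat -> nat) :
  (forall i, staircase n (h i) (w i)) ->
  (forall i j, i != j -> odd (agree n (h i) (h j) + agree n (w i) (w j))) ->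
  #|I| <= M_odd n.
Proof.
move=> S O; apply: (@walks_M_odd n I (fun i => stair_walk n (h i))) => [i|i j ij].
  exact: stair_walkP (S i).
by rewrite (common_staircase (S i) (S j)) O.
Qed.

Lemma agreeC n u v : agree n u v = agree n v u.
Proof. by apply: eq_bigr => x _; rewrite eq_sym. Qed.

Lemma sum_itv n a b : b <= n -> \sum_(x < n) (a <= x < b) = b - a.
Proof.
elim: n b => [|n IHn] b bn; first by rewrite big_ord0; lia.
rewrite big_ord_recr /=; have [{}bn|bn'] := leqP b n.
  by rewrite IHn // andbF addn0.
have -> : b = n.+1 by lia.
rewrite (eq_bigr (fun x : 'I_n => (a <= x < n) : nat)); first by rewrite IHn //; lia.
by move=> [x xn] _ /=; rewrite xn (leqW xn).
Qed.

Lemma agree_itv n u v a b c d : b <= c -> b <= n -> d <= n ->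
  (forall x, x < n -> (u x == v x) = (a <= x < b) || (c <= x < d)) ->
  agree n u v = (b - a) + (d - c).
Proof.
move=> bc bn dn uv; rewrite -(sum_itv a bn) -(sum_itv c dn) -big_split.
by apply: eq_bigr => -[x xn] _ /=; rewrite uv //; do 4?case: leqP => //=; lia.
Qed.

(** * The lower bounds *)

(** The path that makes [c] east steps, [r] north steps, [j] east steps, one
north step, then goes east to the right side and north to the end. *)
Definition comb_h (c r j x : nat) : nat :=
  if x < c then 0 else if x < c + j then r else r.+1.
Definition comb_w (n c r j y : nat) : nat :=
  if y < r then c else if y == r then c + j else n.

Lemma comb_staircase n c r j : c + j <= n -> r < n ->
  staircase n (comb_h c r j) (comb_w n c r j).
Proof.
rewrite /comb_h /comb_w => jn rn.
by split=> [x xn|y yn|x y xn yn]; do ?case: ifP; lia.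
Qed.

Lemma comb_agree_same n c r j j' : c + j' <= n -> r < n -> j < j' ->
  agree n (comb_h c r j) (comb_h c r j') +
  agree n (comb_w n c r j) (comb_w n c r j') = (n - (j' - j)) + n.-1.
Proof.
move=> jn rn jj; rewrite /comb_h /comb_w.
rewrite (@agree_itv _ _ _ 0 (c + j) (c + j') n); try lia; last first.
  by move=> x xn; do ?case: ifP; lia.
rewrite (@agree_itv _ _ _ 0 r r.+1 n); try lia.
by move=> x xn; do ?case: ifP; lia.
Qed.

(** Rows [r] and [r.+1] must be different from [r'] and [r'.+1], so that the
two paths meet along the border only. *)
Lemma comb_agree_apart n c r r' j j' : c + j < n -> c + j' < n -> 0 < j -> 0 < j' ->
  r.+1 < r' -> r' < n ->
  agree n (comb_h c r j) (comb_h c r' j') +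
  agree n (comb_w n c r j) (comb_w n c r' j') = c + (r + (n - r'.+1)).
Proof.
move=> jn jn' j0 j0' rr rn; rewrite /comb_h /comb_w.
rewrite (@agree_itv _ _ _ 0 c n n); try lia; last first.
  by move=> x xn; do ?case: ifP; lia.
rewrite (@agree_itv _ _ _ 0 r r'.+1 n); try lia.
by move=> x xn; do ?case: ifP; lia.
Qed.

Definition comb_fam_h k c (p : 'I_(k + c) * 'I_k) :=
  comb_h c (2 * p.1) (2 * p.2 + 1).
Definition comb_fam_w k c (p : 'I_(k + c) * 'I_k) :=
  comb_w (2 * k + c) c (2 * p.1) (2 * p.2 + 1).

Lemma comb_fam_staircase k c (p : 'I_(k + c) * 'I_k) : c <= 1 ->
  staircase (2 * k + c) (comb_fam_h p) (comb_fam_w p).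
Proof. by case: p => [[a ak] [b bk]] c1; apply: comb_staircase => /=; lia. Qed.

Lemma comb_fam_odd k c (p q : 'I_(k + c) * 'I_k) : c <= 1 -> p != q ->
  odd (agree (2 * k + c) (comb_fam_h p) (comb_fam_h q) +
       agree (2 * k + c) (comb_fam_w p) (comb_fam_w q)).
Proof.
move=> c1; wlog le : p q / (p.1 < q.1) || (p.1 == q.1) && (p.2 < q.2).
  move=> H ne; have [pq|npq] := boolP ((p.1 < q.1) || (p.1 == q.1) && (p.2 < q.2)).
    exact: H.
  rewrite agreeC [X in _ + X]agreeC; apply: H; last by rewrite eq_sym.
  case: p q ne npq => [a b] [a' b'] /=; rewrite xpair_eqE -!val_eqE /=; lia.
move=> _; case: p q le => [[a ha] [b hb]] [[a' ha'] [b' hb']].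
rewrite -val_eqE /= => /orP[aa'|/andP[/eqP aa' bb']].
  rewrite comb_agree_apart /=; lia.
rewrite /comb_fam_h /comb_fam_w /= -aa' comb_agree_same /=; lia.
Qed.

Lemma M_odd_even_lower k : k * k <= M_odd (2 * k).
Proof.
suff H : #|{: 'I_(k + 0) * 'I_k}| <= M_odd (2 * k + 0).
  by move: H; rewrite card_prod !card_ord !addn0.
apply: (@staircases_M_odd _ _ (@comb_fam_h k 0) (@comb_fam_w k 0)) => [p|p q].
  exact: comb_fam_staircase.
exact: comb_fam_odd.
Qed.

(** For [n = 2k + 1], the path that makes [s] north steps, one east step, goes
north to height [2k], then east to the right side and one step north. *)
Definition hook_h (k s x : nat) : nat := if x == 0 then s else 2 * k.
Definition hook_w (k s y : nat) : nat :=
  if y < s then 0 else if y < 2 * k then 1 else 2 * k + 1.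

Lemma hook_staircase k s : s <= 2 * k -> staircase (2 * k + 1) (hook_h k s) (hook_w k s).
Proof.
rewrite /hook_h /hook_w => sk.
by split=> [x xn|y yn|x y xn yn]; do ?case: ifP; lia.
Qed.

Lemma hook_agree k s s' : s < s' -> s' <= 2 * k ->
  agree (2 * k + 1) (hook_h k s) (hook_h k s') +
  agree (2 * k + 1) (hook_w k s) (hook_w k s') = 2 * k + (s + (2 * k + 1 - s')).
Proof.
move=> ss sk; rewrite /hook_h /hook_w.
rewrite (@agree_itv _ _ _ 0 0 1 (2 * k + 1)); try lia; last first.
  by move=> x xn; do ?case: ifP; lia.
rewrite (@agree_itv _ _ _ 0 s s' (2 * k + 1)); try lia.
by move=> x xn; do ?case: ifP; lia.
Qed.

(** A hook meets the highest comb row ([r = 2k]) along its first [j] east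
edges, and the other comb paths in the last north edge; the remaining common
edges lie on the line of abscissa [1], and their number is even. *)
Lemma comb_hook_odd k r s j : ~~ odd r -> ~~ odd s -> odd j ->
  r <= 2 * k -> 0 < s <= 2 * k -> j < 2 * k ->
  odd (agree (2 * k + 1) (comb_h 1 r j) (hook_h k s) +
       agree (2 * k + 1) (comb_w (2 * k + 1) 1 r j) (hook_w k s)).
Proof.
move=> rE sE jO rk sk jk; rewrite /comb_h /comb_w /hook_h /hook_w.
have [->|rk'] : r = 2 * k \/ r < 2 * k by lia.
  rewrite (@agree_itv _ _ _ 1 (1 + j) (1 + j) (1 + j)); try lia; last first.
    by move=> x xn; do ?case: ifP; lia.
  rewrite (@agree_itv _ _ _ s (2 * k) (2 * k) (2 * k)); try lia.
  by move=> x xn; do ?case: ifP; lia.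
rewrite (@agree_itv _ _ _ 0 0 0 0); try lia; last first.
  by move=> x xn; do ?case: ifP; lia.
rewrite (@agree_itv _ _ _ s r (2 * k) (2 * k + 1)); try lia.
by move=> x xn; do ?case: ifP; lia.
Qed.

Lemma M_odd_odd_lower k : k * (k + 2) <= M_odd (2 * k + 1).
Proof.
pose h (i : 'I_(k + 1) * 'I_k + 'I_k) :=
  match i with inl p => comb_fam_h p | inr i => hook_h k (2 * i + 2) end.
pose w (i : 'I_(k + 1) * 'I_k + 'I_k) :=
  match i with inl p => comb_fam_w p | inr i => hook_w k (2 * i + 2) end.
have := @staircases_M_odd (2 * k + 1) _ h w; rewrite card_sum card_prod !card_ord.
have -> : (k + 1) * k + k = k * (k + 2) by lia.
have mixed (p : 'I_(k + 1) * 'I_k) (i : 'I_k) :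
    odd (agree (2 * k + 1) (h (inl p)) (h (inr i)) +
         agree (2 * k + 1) (w (inl p)) (w (inr i))).
  by case: p i => [[a ha] [b hb]] [i hi]; apply: comb_hook_odd => /=; lia.
apply=> [[p|[i hi]]|[p|i] [q|j] ne].
- exact: comb_fam_staircase.
- by apply: hook_staircase => /=; lia.
- exact: comb_fam_odd.
- exact: mixed.
- by rewrite agreeC [X in _ + X]agreeC; exact: mixed.
wlog ij : i j {ne} / i < j.
  move=> H; have [ij|ji|/val_inj ij] := ltngtP i j; first exact: H.
    by rewrite agreeC [X in _ + X]agreeC; exact: H.
  by rewrite ij eqxx in ne.
have jk := ltn_ord j; rewrite hook_agree; lia.
Qed.

(** * Order of magnitude *)

Local Open Scope classical_set_scope.
Local Open Scope ring_scope.

Lemma quadratic_Theta (R : realType) (u : nat -> nat) :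
  (forall n, (0 < n)%N -> (u n <= n ^ 2)%N) ->
  (forall n, (1 < n)%N -> (n ^ 2 <= 4 * u n)%N) ->
  (fun n : nat => (u n)%:R : R^o) \is 'Theta_\oo (fun n : nat => n%:R ^+ 2 : R^o).
Proof.
move=> uU uL; rewrite qualifE /=; apply/asboolP.
exists (4^-1, 1); first by apply/andP; split=> /=; [rewrite invr_gt0 ltr0n | exact: ltr01].
near=> n.
have n1 : (1 < n)%N by near: n; exists 2%N.
rewrite mul1r !ger0_norm ?exprn_ge0 ?ler0n // -!natrX ler_nat uU ?(ltnW n1) //; split=> //.
by rewrite ler_pdivrMl ?ltr0n // -natrM ler_nat uL.
Unshelve. all: end_near. Qed.

Theorem theorem1p5 :
  [/\ (forall n : nat, (0 < n)%N -> (M_odd n <= n * (n - 1) + 1)%N),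
      (forall k : nat, (1 <= k)%N -> (k ^ 2 <= M_odd (2 * k))%N),
      (forall k : nat, (1 <= k)%N -> (k * (k + 2) <= M_odd (2 * k + 1))%N) &
      forall R : realType,
        (fun n : nat => (M_odd n)%:R : R^o) \is
          'Theta_\oo (fun n : nat => n%:R ^+ 2 : R^o)].
Proof.
split=> [n|k _|k _|R].
- exact: M_odd_upper.
- by rewrite -mulnn M_odd_even_lower.
- exact: M_odd_odd_lower.
apply: quadratic_Theta => n n0; first by have := M_odd_upper n0; nia.
have := odd_double_half n; case: (odd n) => nE.
  by have := M_odd_odd_lower n./2; rewrite (_ : 2 * n./2 + 1 = n)%N; nia.
by have := M_odd_even_lower n./2; rewrite (_ : 2 * n./2 = n)%N; nia.
Qed.
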